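(* Let $(\Omega,\leftarrow,\rightarrow,\triangleleft,\triangleright)$ be an extended diassociative semigroup (EDS). If there exists a nonzero graded $\Omega$-dendriform algebra $A$ (over a field $\mathbb{K}$), with $A_0=(0)$, and a homogeneous coproduct $\Delta$ making $\mathbb{K}\Omega\otimes A$ a dendriform bialgebra, then the maps $\varphi_\leftarrow:(\alpha,\beta)\mapsto(\alpha\leftarrow\beta,\alpha\triangleleft\beta)$ and $\varphi_\rightarrow:(\alpha,\beta)\mapsto(\alpha\rightarrow\beta,\alpha\triangleright\beta)$ from $\Omega^2$ to $\Omega^2$ are injective.
   Context: Extended diassociative semigroups. A diassociative semigroup is a set $\Omega$ with maps $\leftarrow,\rightarrow:\Omega\times\Omega\to\Omega$ such that for all $\alpha,\beta,\gamma\in\Omega$: $(\alpha\leftarrow\beta)\leftarrow\gamma=\alpha\leftarrow(\beta\leftarrow\gamma)=\alpha\leftarrow(\beta\rightarrow\gamma)$; $(\alpha\rightarrow\beta)\leftarrow\gamma=\alpha\rightarrow(\beta\leftarrow\gamma)$; $(\alpha\rightarrow\beta)\rightarrow\gamma=(\alpha\leftarrow\beta)\rightarrow\gamma=\alpha\rightarrow(\beta\rightarrow\gamma)$. An extended diassociative semigroup (EDS) is $(\Omega,\leftarrow,\rightarrow,\triangleleft,\triangleright)$ such that $(\Omega,\leftarrow,\rightarrow)$ is a diassociative semigroup and for all $\alpha,\beta,\gamma\in\Omega$: $\alpha\triangleright(\beta\leftarrow\gamma)=\alpha\triangleright\beta$; $(\alpha\rightarrow\beta)\triangleleft\gamma=\beta\triangleleft\gamma$;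 $(\alpha\triangleleft\beta)\leftarrow((\alpha\leftarrow\beta)\triangleleft\gamma)=\alpha\triangleleft(\beta\leftarrow\gamma)$; $(\alpha\triangleleft\beta)\triangleleft((\alpha\leftarrow\beta)\triangleleft\gamma)=\beta\triangleleft\gamma$; $(\alpha\triangleleft\beta)\rightarrow((\alpha\leftarrow\beta)\triangleleft\gamma)=\alpha\triangleleft(\beta\rightarrow\gamma)$; $(\alpha\triangleleft\beta)\triangleright((\alpha\leftarrow\beta)\triangleleft\gamma)=\beta\triangleright\gamma$; $(\alpha\triangleright(\beta\rightarrow\gamma))\leftarrow(\beta\triangleright\gamma)=(\alpha\leftarrow\beta)\triangleright\gamma$; $(\alpha\triangleright(\beta\rightarrow\gamma))\triangleleft(\beta\triangleright\gamma)=\alpha\triangleleft\beta$; $(\alpha\triangleright(\beta\rightarrow\gamma))\rightarrow(\beta\triangleright\gamma)=(\alpha\rightarrow\beta)\triangleright\gamma$; $(\alpha\triangleright(\beta\rightarrow\gamma))\triangleright(\beta\triangleright\gamma)=\alpha\triangleright\beta$. $\Omega$-dendriform algebra: a $\mathbb{K}$-vector space $A$ with bilinear products $\prec_\alpha,\succ_\alpha$ ($\alpha\in\Omega$) such that for all $x,y,z\in A$, $\alpha,\beta\in\Omega$: $(x\prec_\alpha y)\prec_\beta z=x\prec_{\alpha\leftarrow\beta}(y\prec_{\alpha\triangleleft\beta}z)+x\prec_{\alpha\rightarrow\beta}(y\succ_{\alpha\triangleright\beta}z)$; $x\succ_\alpha(y\prec_\beta z)=(x\succ_\alpha y)\prec_\beta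 z$; $x\succ_\alpha(y\succ_\beta z)=(x\succ_{\alpha\triangleright\beta}y)\succ_{\alpha\rightarrow\beta}z+(x\prec_{\alpha\triangleleft\beta}y)\succ_{\alpha\leftarrow\beta}z$. Graded means $A=\bigoplus_{n\ge0}A_n$ with all products homogeneous of degree $0$. The space $\mathbb{K}\Omega\otimes A$ ($\mathbb{K}\Omega$ with basis $\Omega$) is a dendriform algebra with $(\alpha\otimes x)\prec(\beta\otimes y)=(\alpha\leftarrow\beta)\otimes(x\prec_{\alpha\triangleleft\beta}y)$ and $(\alpha\otimes x)\succ(\beta\otimes y)=(\alpha\rightarrow\beta)\otimes(x\succ_{\alpha\triangleright\beta}y)$, graded by $(\mathbb{K}\Omega\otimes A)_n=\mathbb{K}\Omega\otimes A_n$; homogeneous for $\Delta$ means of degree $0$ with respect to this grading. Dendriform algebra: bilinear $\prec,\succ$ with $(x\prec y)\prec z=x\prec(y\prec z+y\succ z)$, $(x\succ y)\prec z=x\succ(y\prec z)$, $(x\prec y+x\succ y)\succ z=x\succ(y\succ z)$. A dendriform bialgebra is $(B,\prec,\succ,\Delta)$ with $(B,\prec,\succ)$ a dendriform algebra, $(B,\Delta)$ a coassociative (not necessarily counital) coalgebra such that, with $\Delta(x)=x'\otimes x''$ (Sweedler) and $\cdot=\prec+\succ$, for all $x,y\in B$: $\Delta(x\prec y)=x\otimes y+x'\prec y\otimes x''+x'\otimes x''\cdot y+x\prec y'\otimes y''+x'\prec y'\otimes x''\cdot y''$ and $\Delta(x\succ y)=y\otimes x+x'\succ y\otimes x''+y'\otimes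 x\cdot y''+x\succ y'\otimes y''+x'\succ y'\otimes x''\cdot y''$. *)

(* Defs.v *)
From HB Require Import structures.
From mathcomp Require Import all_boot all_algebra sesquilinear ring_quotient.
From mathcomp Require Import boolp classical_sets.
From mathcomp.multinomials Require Import freeg.

Set Implicit Arguments.
Unset Strict Implicit.
Unset Printing Implicit Defensive.

Import GRing.Theory.

Local Open Scope ring_scope.
Local Open Scope classical_set_scope.
Local Open Scope quotient_scope.

Notation is_bilinear f := (bilinear_for *:%R *:%R f).

Section Span.
Context (K : fieldType) (V : lmodType K).
Implicit Types S : set V.

Definition span S : {pred V} := fun v =>
  `[< exists s : seq (K * V), (forall p, p \in s -> S p.2)
        /\ v = \sum_(p <- s) p.1 *: p.2 >].

Lemma mem_span S v : S v -> v \in span S.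
Proof.
move=> Sv; apply/asboolP; exists [:: (1, v)]; split; last by rewrite big_seq1 scale1r.
by move=> p; rewrite inE => /eqP->.
Qed.

Lemma span_submod_closed S : submod_closed (span S).
Proof.
split=> [|a u v /asboolP[s [hs ->]] /asboolP[t [ht ->]]]; apply/asboolP.
  by exists [::]; split=> [p|]; [rewrite in_nil|rewrite big_nil].
exists ([seq (a * p.1, p.2) | p <- s] ++ t); split.
  by move=> p; rewrite mem_cat => /orP[/mapP[q qs ->]|/ht//]; exact: hs q qs.
rewrite big_cat big_map scaler_sumr; congr (_ + _).
by apply: eq_bigr => p _; rewrite scalerA.
Qed.

HB.instance Definition _ S :=
  GRing.isSubmodClosed.Build K V (span S)
    (GRing.submod_closed_semi (span_submod_closed S)).

End Span.

Reserved Notation "v *t w" (at level 40, left associativity).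

(* V (x) W is the quotient of the free module on V * W by the span of the
   bilinearity relations.  Its mapping property is [tens_bilinear],
   [tensor_lift_tens], [tensor_lift_linear] and [tensor_generated]. *)
Section Tensor.
Context (K : fieldType) (V W : lmodType K).
Local Notation F := {freeg (V * W)%type / K}.

Definition tensor_relation : set F :=
  [set r | (exists a v v' w,
              r = << (a *: v + v', w) >> - (a *: << (v, w) >> + << (v', w) >>))
        \/ (exists a v w w',
              r = << (v, a *: w + w') >> - (a *: << (v, w) >> + << (v, w') >>))].

Local Notation Q := (Quotient.quot (span tensor_relation)).

Definition tensor : Type := Q.
HB.instance Definition _ := GRing.Zmodule.on tensor.

Definition tens (v : V) (w : W) : tensor := \pi_Q << (v, w) >>.

Lemma tensor_eqP (x y : F) :
  reflect (\pi_Q x = \pi y) (x - y \in span tensor_relation).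
Proof. by rewrite Quotient.idealrBE; apply: eqP. Qed.

Definition tensor_scale (a : K) (t : tensor) : tensor :=
  \pi_Q (a *: repr t).

Lemma tensor_scale_pi a (x : F) :
  tensor_scale a (\pi_Q x) = \pi_Q (a *: x).
Proof.
apply/tensor_eqP; rewrite -scalerBr; apply: rpredZ.
by apply/tensor_eqP; rewrite reprK.
Qed.

Lemma tensor_pi (t : tensor) : exists x : F, t = \pi_Q x.
Proof. by exists (repr (t : Q)); rewrite reprK. Qed.

Fact tensor_scaleA a b t : tensor_scale a (tensor_scale b t) = tensor_scale (a * b) t.
Proof. by have [x ->] := tensor_pi t; rewrite !tensor_scale_pi scalerA. Qed.

Fact tensor_scale1 : left_id 1 tensor_scale.
Proof. by move=> t; have [x ->] := tensor_pi t; rewrite tensor_scale_pi scale1r. Qed.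

Fact tensor_scaleDr : right_distributive tensor_scale +%R.
Proof.
move=> a t u; have [x ->] := tensor_pi t; have [y ->] := tensor_pi u.
by rewrite -raddfD !tensor_scale_pi scalerDr raddfD.
Qed.

Fact tensor_scaleDl t : {morph tensor_scale^~ t : a b / a + b}.
Proof. by move=> a b; have [x ->] := tensor_pi t; rewrite !tensor_scale_pi scalerDl raddfD. Qed.

HB.instance Definition _ := GRing.Zmodule_isLmodule.Build K tensor
  tensor_scaleA tensor_scale1 tensor_scaleDr tensor_scaleDl.

End Tensor.

Arguments tens {K V W} v w.
Notation "v *t w" := (tens v w) : ring_scope.

Section FreeLift.
Context (K : fieldType) (X : choiceType) (U : lmodType K) (f : X -> U).

HB.instance Definition _ := GRing.isZmodMorphism.Build {freeg X / K} U (fglift f)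
  (lift_is_additive f).

Lemma fgliftE (D : {freeg X / K}) : fglift f D = \sum_(x <- dom D) coeff x D *: f x.
Proof.
rewrite -[D in LHS]freeg_sumE raddf_sum /=.
by apply: eq_bigr => x _; rewrite liftU.
Qed.

Lemma fglift_scalable : scalable (fglift f : {freeg X / K} -> U).
Proof.
move=> a D; rewrite [fglift f D]fgliftE -[D in LHS]freeg_sumE !scaler_sumr raddf_sum /=.
apply: eq_bigr => x _.
have -> : a *: << coeff x D *g x >> = << a * coeff x D *g x >> :> {freeg X / K}.
  by apply/eqP/freeg_eqP => y; rewrite coeffZ !coeffU mulrA.
by rewrite liftU scalerA.
Qed.

HB.instance Definition _ := GRing.isScalable.Build K {freeg X / K} U *:%R (fglift f)
  fglift_scalable.

Lemma fgliftU1 x : fglift f << x >> = f x.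
Proof. by rewrite liftU scale1r. Qed.

End FreeLift.

Lemma eq_fglift (K : fieldType) (X : choiceType) (U : lmodType K) (f g : X -> U) :
  f =1 g -> fglift f =1 (fglift g : {freeg X / K} -> U).
Proof. by move=> fg D; rewrite !fgliftE; apply: eq_bigr => x _; rewrite fg. Qed.

Lemma fglift_combination (K : fieldType) (X : choiceType) (U : lmodType K)
    (a : K) (f g : X -> U) (D : {freeg X / K}) :
  fglift (fun x => a *: f x + g x) D = a *: fglift f D + fglift g D.
Proof.
rewrite !fgliftE scaler_sumr -big_split /=; apply: eq_bigr => x _.
by rewrite scalerDr !scalerA mulrC.
Qed.

Section TensorLift.
Context (K : fieldType) (V W : lmodType K).
Local Notation Q := (Quotient.quot (span (@tensor_relation K V W))).

Lemma tens_bilinear : is_bilinear (@tens K V W).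
Proof.
split=> [w a v v'|v a w w'] /=; rewrite /tens.
- transitivity (\pi_Q
    (a *: << (v, w) >> + << (v', w) >>)); last first.
    by rewrite raddfD /=; congr (_ + _); rewrite -tensor_scale_pi.
  by apply/tensor_eqP/mem_span; left; exists a, v, v', w.
- transitivity (\pi_Q
    (a *: << (v, w) >> + << (v, w') >>)); last first.
    by rewrite raddfD /=; congr (_ + _); rewrite -tensor_scale_pi.
  by apply/tensor_eqP/mem_span; right; exists a, v, w, w'.
Qed.

Lemma tensor_generated (t : tensor V W) : exists s : seq (K * (V * W)),
  t = \sum_(p <- s) p.1 *: (p.2.1 *t p.2.2).
Proof.
have [x ->] := tensor_pi t; exists [seq (coeff p x, p) | p <- dom x].
transitivity (\sum_(p <- dom x) (\pi_Q << coeff p x *g p >> : tensor V W)).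
  by rewrite -[x in LHS]freeg_sumE; apply: raddf_sum.
rewrite [RHS]big_map; apply: eq_bigr => -[v w] _ /=.
rewrite -[RHS]/(tensor_scale _ _) tensor_scale_pi; congr (\pi_Q _).
by apply/eqP/freeg_eqP => y; rewrite coeffZ !coeffU mul1r.
Qed.

Context (U : lmodType K).

(* The linear map V (x) W -> U induced by f; only meaningful if f is bilinear. *)
Definition tensor_lift (f : V -> W -> U) (t : tensor V W) : U :=
  fglift (fun p => f p.1 p.2) (repr (t : Q)).

Context (f : V -> W -> U) (f_bilinear : is_bilinear f).

Lemma tensor_lift_pi (x : {freeg (V * W)%type / K}) :
  tensor_lift f (\pi_Q x)
  = fglift (fun p => f p.1 p.2) x.
Proof.
apply/eqP; rewrite /tensor_lift -subr_eq0 -raddfB /=; apply/eqP.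
set g := fun p : V * W => f p.1 p.2.
have /asboolP[s [hs ->]] :
  repr (\pi_Q x) - x
    \in span (@tensor_relation K V W).
  by apply/tensor_eqP; rewrite reprK.
rewrite raddf_sum /= big_seq big1 // => -[c r] /hs /= rel_r; rewrite linearZ /=.
suff -> : fglift g r = 0 by rewrite scaler0.
case: rel_r => [[a [v [v' [w ->]]]]|[a [v [w [w' ->]]]]];
  rewrite raddfB raddfD /= linearZ /= !fgliftU1 /g /=.
- by rewrite (f_bilinear.1 w a v v') subrr.
- by rewrite (f_bilinear.2 v a w w') subrr.
Qed.

Lemma tensor_lift_tens v w : tensor_lift f (v *t w) = f v w.
Proof. by rewrite tensor_lift_pi fgliftU1. Qed.

Lemma tensor_lift_linear : linear (tensor_lift f).
Proof.
move=> a t u; have [x ->] := tensor_pi t; have [y ->] := tensor_pi u.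
transitivity (tensor_lift f (\pi_Q (a *: x + y))).
  by rewrite raddfD /= -tensor_scale_pi.
by rewrite !tensor_lift_pi linearP.
Qed.

End TensorLift.

Lemma eq_tensor_lift (K : fieldType) (V W U : lmodType K) (f g : V -> W -> U) :
  f =2 g -> tensor_lift f =1 tensor_lift g.
Proof. by move=> fg t; apply: eq_fglift => p; apply: fg. Qed.

Lemma tensor_lift_combination (K : fieldType) (V W U : lmodType K)
    (a : K) (f g : V -> W -> U) (t : tensor V W) :
  tensor_lift (fun v w => a *: f v w + g v w) t = a *: tensor_lift f t + tensor_lift g t.
Proof. exact: fglift_combination. Qed.

Section TensorMaps.
Context (K : fieldType) (U V W V' W' : lmodType K).

Definition tensor_map (f : V -> V') (g : W -> W') : tensor V W -> tensor V' W' :=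
  tensor_lift (fun v w => f v *t g w).

Definition tensor_assoc : tensor (tensor U V) W -> tensor U (tensor V W) :=
  tensor_lift (fun t w => tensor_lift (fun u v => u *t (v *t w)) t).

Lemma tensor_map_tens (f : {linear V -> V'}) (g : {linear W -> W'}) v w :
  tensor_map f g (v *t w) = f v *t g w.
Proof.
rewrite /tensor_map tensor_lift_tens //.
by split=> [z a x y|z a x y] /=; rewrite linearP;
  [rewrite (tens_bilinear _ _).1|rewrite (tens_bilinear _ _).2].
Qed.

Lemma tensor_assoc_tens u v w :
  tensor_assoc ((u *t v) *t w) = u *t (v *t w) :> tensor U (tensor V W).
Proof.
have inner w0 : is_bilinear (fun u v => u *t (v *t w0) : tensor U (tensor V W)).
  split=> z a x y /=; first by rewrite (tens_bilinear _ _).1.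
  by rewrite (tens_bilinear _ _).1 (tens_bilinear _ _).2.
rewrite /tensor_assoc tensor_lift_tens ?tensor_lift_tens //.
split=> [z a x y|z a x y] /=; first by rewrite tensor_lift_linear.
rewrite -tensor_lift_combination; apply: eq_tensor_lift => u0 v0.
by rewrite !(tens_bilinear _ _).2.
Qed.

Definition tensor_sub (P : {pred V}) (Q : {pred W}) : {pred tensor V W} :=
  span [set t | exists v w, [/\ v \in P, w \in Q & t = v *t w]].

End TensorMaps.

Section EDS.
Context (Omega : Type).

(* la, ra, lt, rt stand for the left and right arrows and the left and right
   triangles. *)
Record is_diassociative (la ra : Omega -> Omega -> Omega) : Prop := IsDiassociative {
  dias_laA : forall a b c, la (la a b) c = la a (la b c);
  dias_la_ra : forall a b c, la a (la b c) = la a (ra b c);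
  dias_ra_la : forall a b c, la (ra a b) c = ra a (la b c);
  dias_raA : forall a b c, ra (ra a b) c = ra (la a b) c;
  dias_la_raA : forall a b c, ra (la a b) c = ra a (ra b c)
}.

Record is_eds (la ra lt rt : Omega -> Omega -> Omega) : Prop := IsEDS {
  eds_diassociative : is_diassociative la ra;
  eds_rt_la : forall a b c, rt a (la b c) = rt a b;
  eds_ra_lt : forall a b c, lt (ra a b) c = lt b c;
  eds_lt_la : forall a b c, la (lt a b) (lt (la a b) c) = lt a (la b c);
  eds_lt_lt : forall a b c, lt (lt a b) (lt (la a b) c) = lt b c;
  eds_lt_ra : forall a b c, ra (lt a b) (lt (la a b) c) = lt a (ra b c);
  eds_lt_rt : forall a b c, rt (lt a b) (lt (la a b) c) = rt b c;
  eds_rt_la2 : forall a b c, la (rt a (ra b c)) (rt b c) = rt (la a b) c;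
  eds_rt_lt : forall a b c, lt (rt a (ra b c)) (rt b c) = lt a b;
  eds_rt_ra : forall a b c, ra (rt a (ra b c)) (rt b c) = rt (ra a b) c;
  eds_rt_rt : forall a b c, rt (rt a (ra b c)) (rt b c) = rt a b
}.

Record is_Omega_dendriform (la ra lt rt : Omega -> Omega -> Omega)
    (K : fieldType) (A : lmodType K) (prec succ : Omega -> A -> A -> A) : Prop :=
  IsOmegaDendriform {
  Odend_prec_bilinear : forall a, is_bilinear (prec a);
  Odend_succ_bilinear : forall a, is_bilinear (succ a);
  Odend_prec : forall a b x y z,
    prec b (prec a x y) z
    = prec (la a b) x (prec (lt a b) y z) + prec (ra a b) x (succ (rt a b) y z);
  Odend_mid : forall a b x y z, succ a x (prec b y z) = prec b (succ a x y) z;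
  Odend_succ : forall a b x y z,
    succ a x (succ b y z)
    = succ (ra a b) (succ (rt a b) x y) z + succ (la a b) (prec (lt a b) x y) z
}.

End EDS.

Section DendriformBialgebra.
Context (K : fieldType) (B : lmodType K).

Record is_dendriform (prec succ : B -> B -> B) : Prop := IsDendriform {
  dend_prec_bilinear : is_bilinear prec;
  dend_succ_bilinear : is_bilinear succ;
  dend_prec : forall x y z, prec (prec x y) z = prec x (prec y z + succ y z);
  dend_mid : forall x y z, prec (succ x y) z = succ x (prec y z);
  dend_succ : forall x y z, succ (prec x y + succ x y) z = succ x (succ y z)
}.

Definition coassociative (Delta : B -> tensor B B) : Prop :=
  forall x, tensor_assoc (tensor_map Delta id (Delta x)) = tensor_map id Delta (Delta x).

(* [tensor_lift (fun x1 x2 => E) (Delta x)] is the Sweedler expression E for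
   Delta x = x1 (x) x2; every E below is bilinear in (x1, x2). *)
Record is_dendriform_bialgebra (prec succ : B -> B -> B)
    (Delta : {linear B -> tensor B B}) : Prop := IsDendriformBialgebra {
  dbialg_dendriform : is_dendriform prec succ;
  dbialg_coassociative : coassociative Delta;
  dbialg_prec : forall x y,
    Delta (prec x y) =
      x *t y
      + tensor_lift (fun x1 x2 => prec x1 y *t x2) (Delta x)
      + tensor_lift (fun x1 x2 => x1 *t (prec x2 y + succ x2 y)) (Delta x)
      + tensor_lift (fun y1 y2 => prec x y1 *t y2) (Delta y)
      + tensor_lift (fun x1 x2 => tensor_lift (fun y1 y2 =>
          prec x1 y1 *t (prec x2 y2 + succ x2 y2)) (Delta y)) (Delta x);
  dbialg_succ : forall x y,
    Delta (succ x y) =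
      y *t x
      + tensor_lift (fun x1 x2 => succ x1 y *t x2) (Delta x)
      + tensor_lift (fun y1 y2 => y1 *t (prec x y2 + succ x y2)) (Delta y)
      + tensor_lift (fun y1 y2 => succ x y1 *t y2) (Delta y)
      + tensor_lift (fun x1 x2 => tensor_lift (fun y1 y2 =>
          succ x1 y1 *t (prec x2 y2 + succ x2 y2)) (Delta y)) (Delta x)
}.

End DendriformBialgebra.

Section Grading.
Context (K : fieldType) (A : lmodType K).

Record is_grading (A_ : nat -> {pred A}) : Prop := IsGrading {
  grading_submod : forall n, submod_closed (A_ n);
  grading_sum : forall a, exists N (x : nat -> A),
    (forall n, x n \in A_ n) /\ a = \sum_(n < N) x n;
  grading_direct : forall N (x : nat -> A), (forall n, x n \in A_ n) ->
    \sum_(n < N) x n = 0 -> forall n, (n < N)%N -> x n = 0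
}.

Definition homogeneous_product (A_ : nat -> {pred A}) (p : A -> A -> A) : Prop :=
  forall i j x y, x \in A_ i -> y \in A_ j -> p x y \in A_ (i + j)%N.

(* Degree n part of A (x) A: the sum of the A_ i (x) A_ j over i + j = n. *)
Definition tensor_degree (A_ : nat -> {pred A}) (n : nat) : {pred tensor A A} :=
  span [set t | exists i j, (i + j = n)%N /\ t \in tensor_sub (A_ i) (A_ j)].

Definition homogeneous_coproduct (A_ : nat -> {pred A}) (Delta : A -> tensor A A) : Prop :=
  forall n x, x \in A_ n -> Delta x \in tensor_degree A_ n.

End Grading.

Section FreeTensor.
Context (K : fieldType) (Omega : choiceType) (A : lmodType K).
Local Notation KOmega := {freeg Omega / K}.

(* The bilinear product on KOmega (x) A determined on the generators by
   (a (x) x, b (x) y) |-> op a b (x) m (act a b) x y, see [twisted_product_tens]. *)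
Definition twisted_product (op act : Omega -> Omega -> Omega) (m : Omega -> A -> A -> A)
    (s t : tensor KOmega A) : tensor KOmega A :=
  tensor_lift (fun u x => tensor_lift (fun v y =>
    fglift (fun a => fglift (fun b => << op a b >> *t m (act a b) x y) v) u) t) s.

Definition free_tensor_degree (A_ : nat -> {pred A}) (n : nat) : {pred tensor KOmega A} :=
  tensor_sub predT (A_ n).

Section Product.
Context (op act : Omega -> Omega -> Omega) (m : Omega -> A -> A -> A).
Context (m_bilinear : forall a, is_bilinear (m a)).

Let core (u : KOmega) x (v : KOmega) y : tensor KOmega A :=
  fglift (fun a => fglift (fun b => << op a b >> *t m (act a b) x y) v) u.

Let core_vy u x : is_bilinear (core u x).
Proof.
rewrite /core; split=> [y a v v'|v a y y'] /=; rewrite -fglift_combination;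
  apply: eq_fglift => i; first by rewrite linearP.
rewrite -fglift_combination; apply: eq_fglift => j.
by rewrite (m_bilinear _).2 (tens_bilinear _ _).2.
Qed.

Let core_ux t : is_bilinear (fun u x => tensor_lift (core u x) t).
Proof.
split=> [x a u u'|u a x x'] /=; rewrite -tensor_lift_combination;
  apply: eq_tensor_lift => v y; first by rewrite /core linearP.
rewrite /core -fglift_combination; apply: eq_fglift => i.
rewrite -fglift_combination; apply: eq_fglift => j.
by rewrite (m_bilinear _).1 (tens_bilinear _ _).2.
Qed.

Lemma twisted_product_bilinear : is_bilinear (twisted_product op act m).
Proof.
split=> [t|s].
  by move=> a s s'; apply: (tensor_lift_linear (core_ux t)).
move=> a t t'; rewrite /twisted_product -tensor_lift_combination.
by apply: eq_tensor_lift => u x; rewrite (tensor_lift_linear (core_vy u x)).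
Qed.

Lemma twisted_product_tens a b x y :
  twisted_product op act m (<< a >> *t x) (<< b >> *t y)
  = << op a b >> *t m (act a b) x y.
Proof.
rewrite /twisted_product (tensor_lift_tens (core_ux _)) (tensor_lift_tens (core_vy _ _)).
by rewrite /core !fgliftU1.
Qed.

End Product.
End FreeTensor.

Arguments free_tensor_degree {K} Omega {A} A_ n _.

(* Main.v *)
Require Import Defs.
From mathcomp Require Import all_boot all_algebra.
From mathcomp.multinomials Require Import freeg.
From mathcomp Require Import boolp classical_sets.

(** Let n be the least degree with A_n nonzero; n > 0 since A_0 = 0.  Degree n of
    the tensor square of B = KOmega (x) A vanishes, as one factor always has degree
    below n, so every element of B_n is killed by Delta.  For such elements the
    bialgebra axioms collapse to Delta(u < v) = u (x) v and Delta(u > v) = v (x) u.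
    With x nonzero in A_n, the product of alpha (x) x and beta (x) x depends only on
    the image of (alpha, beta) under the map in question, while its coproduct
    determines (alpha, beta). *)

Set Implicit Arguments.
Unset Strict Implicit.
Unset Printing Implicit Defensive.

Import GRing.Theory.

Local Open Scope ring_scope.

Section LinearMaps.
Context (K : fieldType).

Lemma linear_at0 (V W : lmodType K) (f : V -> W) : linear f -> f 0 = 0.
Proof.
by move=> f_lin; have := f_lin (-1) 0 0; rewrite !scaleN1r !addNr.
Qed.

(* A maximal linearly closed set avoiding x is a hyperplane complementary to the
   line spanned by x. *)
Lemma separating_functional (V : lmodType K) (x : V) : x <> 0 ->
  exists f : V -> K^o, linear f /\ f x = 1.
Proof.
move=> x0.
pose P (M : set V) := (forall a u v, M u -> M v -> M (a *: u + v)) /\ ~ M x.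
have [F FP Fchain|M [[M_closed Mx] M_max]] := @Zorn_bigcup _ P.
  split=> [a u v [X FX Xu] [Y FY Yv]|[X FX]]; last exact: (FP _ FX).2.
  have [XY|YX] := Fchain _ _ FX FY.
    by exists Y => //; apply: (FP _ FY).1 => //; apply: XY.
  by exists X => //; apply: (FP _ FX).1 => //; apply: YX.
(* [P] holds of the empty set, the union of the empty chain, so 0 in [M] must come from maximality:
   without 0, [M] would be empty, hence strictly inside the zero subspace. *)
have M0 : M 0.
  apply: contrapT => nM0; apply: (M_max (fun u => u = 0)); last first.
    by split=> // a u v -> ->; rewrite scaler0 addr0.
  split=> [u Mu|sub0M]; last exact/nM0/sub0M.
  by case: nM0; rewrite -(addNr u) -scaleN1r; apply: M_closed.
have MZ a u : M u -> M (a *: u) by move=> Mu; rewrite -[_ *: u]addr0; apply: M_closed.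
have MB u v : M u -> M v -> M (u - v).
  by move=> Mu Mv; rewrite addrC -scaleN1r; apply: M_closed.
have coord y : exists c, M (y - c *: x).
  (* Otherwise the strictly larger [M] + Ky still avoids x: from x = m + ay, with a nonzero since x
     is not in [M], one gets y - x/a in [M]. *)
  apply: contrapT => no_c.
  pose B u := exists m a, M m /\ u = m + a *: y.
  apply: (M_max B).
    split=> [u Mu|BM]; first by exists u, 0; rewrite scale0r addr0.
    apply: no_c; exists 0; rewrite scale0r subr0; apply: BM.
    by exists 0, 1; rewrite scale1r add0r.
  split=> [a u v [m [b [Mm ->]]] [k [c [Mk ->]]]|[m [a [Mm x_def]]]].
    exists (a *: m + k), (a * b + c); split; first exact: M_closed.
    by rewrite scalerDr scalerA scalerDl addrACA.
  have a0 : a != 0.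
    by apply/eqP=> a0; apply: Mx; rewrite x_def a0 scale0r addr0.
  apply: no_c; exists a^-1.
  rewrite x_def scalerDr scalerA mulVf // scale1r opprD addrCA subrr addr0.
  by rewrite -scaleN1r; apply/MZ/MZ.
have coord_uniq y c d : M (y - c *: x) -> M (y - d *: x) -> c = d.
  move=> Mc Md; apply/eqP; rewrite -subr_eq0; apply/eqP; apply: contrapT => /eqP cd0.
  apply: Mx; rewrite -[x]scale1r -(mulVf cd0) -scalerA; apply: MZ.
  have := MB _ _ Md Mc.
  by rewrite opprB addrC addrA subrK scalerBl.
(* The functional is the coordinate along x modulo [M]; uniqueness makes it linear. *)
have [f fP] := choice coord; exists f; split=> [a u v|].
  apply: (coord_uniq (a *: u + v)) => //.
  rewrite scalerDl -scalerA opprD addrACA -scalerBr.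
  exact: M_closed.
by apply: (coord_uniq x) => //; rewrite scale1r subrr.
Qed.

Lemma mul_bilinear (V W : lmodType K) (p : V -> K^o) (q : W -> K^o) :
  linear p -> linear q -> is_bilinear (fun v w => p v * q w : K^o).
Proof.
move=> p_lin q_lin; split=> [w a v v'|v a w w'] /=.
  by rewrite p_lin mulrDl scalerAl.
by rewrite q_lin mulrDr scalerAr.
Qed.

Lemma tens_maps_bilinear (V W V' W' : lmodType K) (p : V -> V') (q : W -> W') :
  linear p -> linear q -> is_bilinear (fun v w => p v *t q w).
Proof.
move=> p_lin q_lin; split=> [w a v v'|v a w w'] /=.
  by rewrite p_lin (tens_bilinear _ _).1.
by rewrite q_lin (tens_bilinear _ _).2.
Qed.

(** This disposes of the Sweedler terms over a zero coproduct. As [tensor_lift] evaluates on a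
    chosen representative, the vanishing at 0 rests on bilinearity. *)
Lemma tensor_lift_maps0 (V W V' W' : lmodType K) (p : V -> V') (q : W -> W') :
  linear p -> linear q -> tensor_lift (fun v w => p v *t q w) 0 = 0.
Proof.
by move=> p_lin q_lin; apply/linear_at0/tensor_lift_linear/tens_maps_bilinear.
Qed.

Lemma tens0 (V W : lmodType K) (v : V) : v *t (0 : W) = 0.
Proof. exact: linear_at0 ((tens_bilinear _ _).2 v). Qed.

Lemma span_eq0 (V : lmodType K) (S : set V) (v : V) :
  (forall u, S u -> u = 0) -> v \in Defs.span S -> v = 0.
Proof.
move=> S0 /asboolP[s [sS ->]]; rewrite big_seq big1 // => p /sS/S0->.
exact: scaler0.
Qed.

Lemma tensor_sub_eq0l (V W : lmodType K) (P : {pred V}) (Q : {pred W}) t :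
  (forall v, v \in P -> v = 0) -> t \in tensor_sub P Q -> t = 0.
Proof.
move=> P0; apply: span_eq0 => _ [v [w [/P0-> _ ->]]].
exact: linear_at0 ((tens_bilinear _ _).1 w).
Qed.

Lemma tensor_sub_eq0r (V W : lmodType K) (P : {pred V}) (Q : {pred W}) t :
  (forall w, w \in Q -> w = 0) -> t \in tensor_sub P Q -> t = 0.
Proof. by move=> Q0; apply: span_eq0 => _ [v [w [_ /Q0-> ->]]]; apply: tens0. Qed.

Lemma tensor_degree_eq0 (V : lmodType K) (V_ : nat -> {pred V}) n t :
  (0 < n)%N -> (forall i, (i < n)%N -> forall v, v \in V_ i -> v = 0) ->
  t \in tensor_degree V_ n -> t = 0.
Proof.
move=> n0 V0; apply: span_eq0 => u [i [j [ij]]].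
(* If i is at least n then j = 0, which is below n because n is positive. *)
have [i_lt|j_lt] : (i < n)%N \/ (j < n)%N.
- have [|ni] := ltnP i n; first by left.
  by right; rewrite -ij -subn_gt0 addnK (leq_trans n0).
- by apply: tensor_sub_eq0l; apply: V0.
- by apply: tensor_sub_eq0r; apply: V0.
Qed.

End LinearMaps.

Section Primitive.
Context (K : fieldType) (B : lmodType K) (prec succ : B -> B -> B).
Context (Delta : {linear B -> tensor B B}).
Context (B_bialg : is_dendriform_bialgebra prec succ Delta).

Let precP := dend_prec_bilinear (dbialg_dendriform B_bialg).
Let succP := dend_succ_bilinear (dbialg_dendriform B_bialg).

Let id_lin : linear (fun x : B => x). Proof. by []. Qed.

Let mul_l x : linear (fun y => prec x y + succ x y).
Proof. by move=> a y y'; rewrite precP.2 succP.2 scalerDr addrACA. Qed.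

Let mul_r y : linear (fun x => prec x y + succ x y).
Proof. by move=> a x x'; rewrite precP.1 succP.1 scalerDr addrACA. Qed.

Let lift_const0 (t : tensor B B) : tensor_lift (fun _ _ => 0 : tensor B B) t = 0.
Proof. by rewrite /tensor_lift fgliftE big1 // => z _; rewrite scaler0. Qed.

(** Every term of the axiom except the leading one is a lift over [Delta x] or [Delta y]. *)
Lemma coproduct_prec_primitive x y :
  Delta x = 0 -> Delta y = 0 -> Delta (prec x y) = x *t y.
Proof.
move=> Dx Dy; rewrite (dbialg_prec B_bialg) Dx Dy.
rewrite (tensor_lift_maps0 (precP.1 y) id_lin) (tensor_lift_maps0 id_lin (mul_r y)).
rewrite (tensor_lift_maps0 (precP.2 x) id_lin).
(* In the double Sweedler term the inner lift, over [Delta y] = 0, vanishes for all [x1], [x2]; the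
   outer one is then a lift of the constant 0. *)
under eq_tensor_lift => x1 x2 do
  rewrite (tensor_lift_maps0 (precP.2 x1) (mul_l x2)).
by rewrite lift_const0 !addr0.
Qed.

Lemma coproduct_succ_primitive x y :
  Delta x = 0 -> Delta y = 0 -> Delta (succ x y) = y *t x.
Proof.
move=> Dx Dy; rewrite (dbialg_succ B_bialg) Dx Dy.
rewrite (tensor_lift_maps0 (succP.1 y) id_lin) (tensor_lift_maps0 id_lin (mul_l x)).
rewrite (tensor_lift_maps0 (succP.2 x) id_lin).
under eq_tensor_lift => x1 x2 do
  rewrite (tensor_lift_maps0 (succP.2 x1) (mul_l x2)).
by rewrite lift_const0 !addr0.
Qed.

End Primitive.

(** Pair both sides with [g a] on the first factor and [g b] on the second, where [g c] reads the
    coefficient of c and applies a functional equal to 1 at x. The left side gives 1, the right side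
    a product of Kronecker deltas. *)
Lemma tens_basis_inj (K : fieldType) (Omega : choiceType) (A : lmodType K) (x : A)
    (a b a' b' : Omega) : x <> 0 ->
  (<< a >> *t x : tensor {freeg Omega / K} A) *t (<< b >> *t x)
    = (<< a' >> *t x) *t (<< b' >> *t x) ->
  a = a' /\ b = b'.
Proof.
move=> x0; have [f [f_lin fx]] := separating_functional x0.
pose d (c e : Omega) : K^o := (e == c)%:R.
have d_lin c : linear (fglift (d c)) by move=> k u v; rewrite linearP.
pose g c : tensor {freeg Omega / K} A -> K^o :=
  tensor_lift (fun u y => fglift (d c) u * f y : K^o).
have g_lin c : linear (g c) by apply/tensor_lift_linear/mul_bilinear.
have gE c e : g c (<< e >> *t x) = (e == c)%:R.
  by rewrite /g (tensor_lift_tens (mul_bilinear (d_lin c) f_lin)) fx mulr1 fgliftU1.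
move/(congr1 (tensor_lift (fun s t => g a s * g b t : K^o))).
rewrite !(tensor_lift_tens (mul_bilinear (g_lin a) (g_lin b))) !gE !eqxx mulr1.
case: eqP => [->|_]; last by rewrite mul0r => /eqP; rewrite oner_eq0.
by case: eqP => [->|_] //; rewrite mulr0 => /eqP; rewrite oner_eq0.
Qed.

Lemma grading_least_degree (K : fieldType) (A : lmodType K) (A_ : nat -> {pred A}) :
  is_grading A_ -> (exists x : A, x <> 0) ->
  exists n x, [/\ x \in A_ n, x <> 0 &
    forall i, (i < n)%N -> forall y, y \in A_ i -> y = 0].
Proof.
move=> A_gr [a a0].
pose nz n := `[< exists2 x, x \in A_ n & x <> 0 >].
have ex_nz : exists n, nz n.
  apply: contrapT => all0; apply: a0.
  have [N [x [xA ->]]] := grading_sum A_gr a; apply: big1 => n _.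
  by apply: contrapT => xn0; apply: all0; exists n; apply/asboolP; exists (x n).
have [n /asboolP[x xA x0] n_min] := ex_minnP ex_nz; exists n, x; split=> // i i_lt y yA.
apply: contrapT => y0; move: i_lt; rewrite ltnNge n_min //.
by apply/asboolP; exists y.
Qed.

Theorem proposition38 (K : fieldType) (Omega : choiceType)
    (la ra lt rt : Omega -> Omega -> Omega) (Omega_eds : is_eds la ra lt rt) :
  (exists (A : lmodType K) (prec succ : Omega -> A -> A -> A)
      (A_ : nat -> {pred A})
      (Delta : {linear tensor {freeg Omega / K} A ->
                  tensor (tensor {freeg Omega / K} A) (tensor {freeg Omega / K} A)}),
      (exists x : A, x <> 0%R)
      /\ is_Omega_dendriform la ra lt rt prec succ
      /\ is_grading A_
      /\ (forall a : Omega, homogeneous_product A_ (prec a))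
      /\ (forall a : Omega, homogeneous_product A_ (succ a))
      /\ (forall x : A, x \in A_ 0%N -> x = 0%R)
      /\ homogeneous_coproduct (free_tensor_degree Omega A_) Delta
      /\ is_dendriform_bialgebra (twisted_product la lt prec)
           (twisted_product ra rt succ) Delta) ->
  injective (fun p : Omega * Omega => (la p.1 p.2, lt p.1 p.2))
  /\ injective (fun p : Omega * Omega => (ra p.1 p.2, rt p.1 p.2)).
Proof.
move=> [A [prec [succ [A_ [Delta [A_nz [A_dend [A_gr [_ [_ [A0 [D_hom B_bialg]]]]]]]]]]]].
have [n [x [xA x0 A_lt]]] := grading_least_degree A_gr A_nz.
have n_gt0 : (0 < n)%N.
  by case: n xA {A_lt} => // xA; case: x0; apply: A0.
have prim a : Delta (<< a >> *t x) = 0.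
  (* The vanishing of [A_ i] for i below n passes to the grading of the tensor product with the free
     module. *)
  apply: (@tensor_degree_eq0 _ _ (free_tensor_degree Omega A_) n) => //.
    by move=> i /A_lt Ai0 t; apply: tensor_sub_eq0r.
  by apply: D_hom; apply: mem_span; exists << a >>, x.
have prec_bil := Odend_prec_bilinear A_dend.
have succ_bil := Odend_succ_bilinear A_dend.
split=> -[a b] [a' b'] /= [eq_op eq_act].
  have [] // := @tens_basis_inj K _ _ _ a b a' b' x0; last by move=> -> ->.
  (* Rewritten backwards, both tensors are coproducts of products, and these products agree by
     [eq_op] and [eq_act]. *)
  rewrite -!(coproduct_prec_primitive B_bialg) ?prim //.
  by rewrite !(twisted_product_tens _ _ prec_bil) eq_op eq_act.
(* The coproduct of a [succ] product swaps the factors, hence the order b, a. *)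
have [] // := @tens_basis_inj K _ _ _ b a b' a' x0; last by move=> -> ->.
rewrite -!(coproduct_succ_primitive B_bialg) ?prim //.
by rewrite !(twisted_product_tens _ _ succ_bil) eq_op eq_act.
Qed.
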